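(* Let $N\ge9$, $\alpha\in\{2,3,4\}$ with $\alpha\mid N$, and $M_\alpha=N/\alpha$. Let $g$ be a $2\times5$ matrix over $\mathbb{Z}_N$ generating an admissible linear code, with columns indexed by $i=0,\dots,4$ and $\gcd_i=\gcd(g_{1i},g_{2i},N)$. Suppose exactly one column of $g$ has $\gcd_i=M_\alpha$ and the other columns have $\gcd_i<M_\alpha$. Then $g$ does not generate a thin linear code, unless $g$ has a column of zeros.
   Context: $\mathbb{Z}_N=\mathbb{Z}/N\mathbb{Z}$; its elements are identified with the representatives $0,1,\dots,N-1$, and gcd's are taken of these integers. The code generated by $g$ is the submodule of $\mathbb{Z}_N^5$ generated by the rows of $g$. A linear code is extended if every word has coordinate sum $0\bmod N$; call it admissible if it is extended and the greatest common divisor of $N$ and all entries of all words (equivalently of $N$ and all entries of $g$) is $1$. An extended code is thin if it contains no word all of whose entries are nonzero. *)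

(* Defs.v *)
From mathcomp Require Export all_boot all_order all_algebra.

Set Implicit Arguments.
Unset Strict Implicit.
Unset Printing Implicit Defensive.

Import GRing.Theory.
Local Open Scope ring_scope.

(* Words are row vectors over 'Z_N; an element of 'Z_N coerces to its
   representative in 0, ..., N - 1 (for N > 1), and gcds are taken of these
   natural numbers. *)
Section Codes.

Variables (N n : nat).
Implicit Types C : {set 'rV['Z_N]_n}.

Definition generated_code (m : nat) (g : 'M['Z_N]_(m, n)) :
    {set 'rV['Z_N]_n} :=
  [set \sum_(k < m) c 0 k *: row k g | c : 'rV['Z_N]_m].

Definition extended C : Prop :=
  forall w : 'rV['Z_N]_n, w \in C -> \sum_(i < n) w 0 i = 0.

Definition content C : nat :=
  gcdn N (\big[gcdn/0%N]_(w in C) \big[gcdn/0%N]_(i < n) (w 0 i : nat)).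

Definition admissible C : Prop := extended C /\ content C = 1%N.

Definition thin C : Prop :=
  extended C /\
  ~ exists w : 'rV['Z_N]_n, w \in C /\ forall i : 'I_n, w 0 i != 0.

Definition col_gcd (g : 'M['Z_N]_(2, n)) (i : 'I_n) : nat :=
  gcdn (gcdn (g 0 i) (g 1 i)) N.

Lemma generated_code_submod m (g : 'M['Z_N]_(m, n)) :
  submod_closed (generated_code g).
Proof.
split=> [|a u v /imsetP[c _ ->] /imsetP[d _ ->]]; apply/imsetP.
  by exists 0; rewrite // big1 // => k _; rewrite mxE scale0r.
exists (a *: c + d) => //; rewrite scaler_sumr -big_split /=.
by apply: eq_bigr => k _; rewrite !mxE scalerDl scalerA.
Qed.

Lemma row_generated_code m (g : 'M['Z_N]_(m, n)) k :
  row k g \in generated_code g.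
Proof.
apply/imsetP; exists (delta_mx 0 k) => //.
rewrite (bigD1 k) //= big1 ?mxE ?eqxx ?scale1r ?addr0 // => j /negPf nkj.
by rewrite mxE nkj andbF scale0r.
Qed.

Lemma generated_code_min m (g : 'M['Z_N]_(m, n)) C :
    submod_closed C -> (forall k, row k g \in C) ->
  generated_code g \subset C.
Proof.
move=> [C0 CD] Cg; apply/subsetP=> _ /imsetP[c _ ->].
by elim/big_rec: _ => // k w _; apply: CD.
Qed.

End Codes.

(* Main.v *)
(** Column [j] is a linear form on [Z_N^2] with kernel [K_j] of index
    [m_j = N / gcd_j], and the code is thin iff the [K_j] cover [Z_N^2].  Since
    [K_0] and [K_j] meet in a set of density at least the product of their
    densities, a cover forces [1 <= sum_(j <> 0) 1 / m_j].  The forms sum to [0]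
    and have content [1], so every prime power dividing [N] divides at least two
    of the [m_j].  This settles [alpha = 3, 4].  For [alpha = 2] and an odd prime
    [p | N], the Chinese remainder theorem lets one avoid the kernels with
    [p | m_j] and the others separately, which succeeds unless more than [p]
    columns have [p | m_j]; so [p = 3] and all four other columns are concerned.
    Unless [N] divides [6], two of the [m_j] are then at least [9], against
    [2/9 + 2/3 < 1]. *)

Require Import Defs.
From mathcomp Require Import all_fingroup zify.
Import GRing.Theory.
Local Open Scope ring_scope.

(** * Covering a finite group by subgroups *)

(** By the product bound on densities of intersections, [H i] fills at most the fraction
    [#|H i| / #|G|] of the complement of [H0], which is nonempty. *)
Lemma card_le_sum_cover (gT : finGroupType) (I : finType) (G H0 : {group gT})
    (H : I -> {group gT}) (P : pred I) :
    H0 \proper G -> (forall i, P i -> H i \subset G) ->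
    (forall x, x \in G -> x \notin H0 -> exists2 i, P i & x \in H i) ->
  (#|G| <= \sum_(i | P i) #|H i|)%N.
Proof.
move=> /[dup] /proper_card ltH0 /proper_sub sH0 sH cover.
have -> : (#|G| = #|H0| + #|G :\: H0|)%N.
  by rewrite -(cardsID H0 G) (setIidPr sH0).
have leD : (#|G :\: H0| <= \sum_(i | P i) #|H i :\: H0|)%N.
  apply: (@leq_trans #|\bigcup_(i | P i) (H i :\: H0)|).
    apply/subset_leq_card/subsetP => x /setDP[Gx H0x].
    have [i Pi Hx] := cover x Gx H0x.
    by apply/bigcupP; exists i; rewrite // inE H0x.
  elim/big_rec2: _ => [|i m A _ leA]; first by rewrite cards0.
  by rewrite (leq_trans (leq_card_setU _ _)) // leq_add2l.
have {leD} : (#|G| * #|G :\: H0| <=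
              \sum_(i | P i) #|H i| * #|G :\: H0|)%N.
  rewrite (leq_trans (leq_mul (leqnn _) leD)) // big_distrr /=.
  apply: leq_sum => i Pi.
  have : (#|H i| * #|H0| <= #|G| * #|H i :&: H0|)%N.
    (* The left side is the size of the product set, which lies in [G], times that of the
       intersection. *)
    by rewrite mul_cardG leq_mul2r subset_leq_card ?orbT ?mul_subG ?sH.
  rewrite -(cardsID H0 (H i)) -(cardsID H0 G) (setIidPr sH0).
  by move: #|H i :&: H0| #|H i :\: H0| #|H0| #|G :\: H0| => a b c d; nia.
have : (0 < #|G :\: H0|)%N.
  by have := cardsID H0 G; rewrite (setIidPr sH0); lia.
rewrite -big_distrl /= => gt0; rewrite leq_pmul2r //.
by have := cardsID H0 G; rewrite (setIidPr sH0) => <-.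
Qed.

(** * Divisibility in ['Z_N], Bezout and lcms *)

Lemma Zp_natr_eq0 (N k : nat) : (1 < N)%N -> ((k%:R : 'Z_N) == 0) = (N %| k)%N.
Proof. by move=> N_gt1; rewrite -val_eqE /= val_Zp_nat. Qed.

Lemma Zp_mulrn_eq0 (N k : nat) (x : 'Z_N) :
  (1 < N)%N -> (x *+ k == 0) = (N %| k * x)%N.
Proof.
by move=> N_gt1; rewrite -Zp_natr_eq0 // natrM natr_Zp mulr_natl.
Qed.

Lemma Zp_coprime_mulrn_eq0 (N q r : nat) (x : 'Z_N) :
  (1 < N)%N -> coprime q r -> x *+ q = 0 -> x *+ r = 0 -> x = 0.
Proof.
move=> N_gt1 /eqP cqr /eqP; rewrite Zp_mulrn_eq0 // => dq /eqP.
rewrite Zp_mulrn_eq0 // => dr; apply/eqP.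
by rewrite -[x]mulr1n Zp_mulrn_eq0 // -cqr muln_gcdl dvdn_gcd dq.
Qed.

Lemma natr_Bezout (R : pzRingType) (a b : nat) :
  exists u v : R, u * a%:R + v * b%:R = (gcdn a b)%:R.
Proof.
have [u [v uv]] := Bezoutz a b.
exists u%:~R, v%:~R.
by rewrite -[a%:R]/(a%:Z%:~R) -[b%:R]/(b%:Z%:~R) -!rmorphM -rmorphD uv.
Qed.

(* For a prime power the lcm behaves like a maximum. *)
Lemma pfactor_dvd_biglcm (I : finType) (P : pred I) (F : I -> nat) (p e : nat) :
    prime p -> (0 < e)%N -> (p ^ e %| \big[lcmn/1%N]_(i | P i) F i)%N ->
  exists2 i, P i & (p ^ e %| F i)%N.
Proof.
move=> p_pr e_gt0 dvL; apply/exists_inP; apply: contraLR dvL => /exists_inPn nF.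
elim/big_rec: _ => [|i m Pi nm].
  by rewrite dvdn1 -(exp1n e) eqn_exp2r // neq_ltn prime_gt1 ?orbT.
have [F0|F_gt0] := posnP (F i); first by have := nF i Pi; rewrite F0 dvdn0.
have [m0|m_gt0] := posnP m; first by move: nm; rewrite m0 dvdn0.
rewrite pfactor_dvdn ?lcmn_gt0 ?F_gt0 // logn_lcm // leq_max negb_or.
by rewrite -!pfactor_dvdn // nm (nF i Pi).
Qed.

(** * Orders and kernels of columns *)

Section Columns.

Variables (N n : nat).
Hypothesis N_gt1 : (1 < N)%N.
Implicit Types (g : 'M['Z_N]_(2, n)) (j : 'I_n).

(** The additive order of the column, as [col_mulrn_eq0] shows. *)
Definition col_order g j : nat := (N %/ col_gcd g j)%N.

Definition col_ker g j : {set 'rV['Z_N]_2} := [set v | (v *m g) 0 j == 0].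

Lemma col_gcd_gt0 g j : (0 < col_gcd g j)%N.
Proof. by rewrite gcdn_gt0 (ltnW N_gt1) orbT. Qed.

Lemma col_gcdM_order g j : (col_gcd g j * col_order g j = N)%N.
Proof. by rewrite mulnC divnK ?dvdn_gcdr. Qed.

Lemma col_order_gt0 g j : (0 < col_order g j)%N.
Proof. by have := col_gcdM_order g j; case: col_order; lia. Qed.

Lemma col_mulrn_eq0 g j k : (col j g *+ k == 0) = (col_order g j %| k)%N.
Proof.
rewrite dvdn_divLR ?col_gcd_gt0 ?dvdn_gcdr // !muln_gcdr !dvdn_gcd.
(* The condition from [N] in the gcd always holds; one condition per row of [g] remains. *)
rewrite [X in _ && X]dvdn_mull // andbT -!Zp_mulrn_eq0 //; apply/eqP/andP => [/matrixP cE | [/eqP E0 /eqP E1]].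
  by have := cE 0 0; have := cE 1 0; rewrite !mulmxnE !mxE => -> ->.
apply/matrixP => i l; rewrite mulmxnE !mxE; case: i => [[|[|//]] lt_i].
  by rewrite -[RHS]E0; congr (g _ _ *+ _); apply/val_inj.
by rewrite -[RHS]E1; congr (g _ _ *+ _); apply/val_inj.
Qed.

Lemma mulmx_colD g (v w : 'rV['Z_N]_2) j :
  ((v + w) *m g) 0 j = (v *m g) 0 j + (w *m g) 0 j.
Proof. by rewrite mulmxDl mxE. Qed.

Lemma mulmx_colMn g (v : 'rV['Z_N]_2) j k :
  ((v *+ k) *m g) 0 j = (v *m g) 0 j *+ k.
Proof. by rewrite -scaler_nat -scalemxAl scaler_nat mulmxnE. Qed.

Lemma mulmx_col_mulrn g (v : 'rV['Z_N]_2) j k :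
  (v *m g) 0 j *+ k = (v *m (col j g *+ k)) 0 0.
Proof.
rewrite raddfMn /= mulmxnE; congr (_ *+ _).
by rewrite !mxE; apply: eq_bigr => i _; rewrite mxE.
Qed.

Lemma mulmx_col_order g (v : 'rV['Z_N]_2) j :
  (v *m g) 0 j *+ col_order g j = 0.
Proof.
have /eqP c0 : col j g *+ col_order g j == 0 by rewrite col_mulrn_eq0.
by rewrite mulmx_col_mulrn c0 mulmx0 mxE.
Qed.

(** Bezout twice; the multiple of [N] in the second identity vanishes in ['Z_N]. *)
Lemma col_gcd_image g j : exists v : 'rV['Z_N]_2, (v *m g) 0 j = (col_gcd g j)%:R.
Proof.
have [u1 [v1 E1]] := natr_Bezout 'Z_N (g 0 j) (g 1 j).
have [u2 [v2 E2]] := natr_Bezout 'Z_N (gcdn (g 0 j) (g 1 j)) N.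
have N0 : N%:R = 0 :> 'Z_N by apply/eqP; rewrite Zp_natr_eq0.
exists (\row_i (if i == 0 then u2 * u1 else u2 * v1)).
rewrite -E2 N0 mulr0 addr0 -E1 !natr_Zp mulrDr !mulrA.
rewrite mxE big_ord_recl big_ord1 !mxE /=.
by congr (_ + _ * g _ _); apply/val_inj.
Qed.

Lemma col_ker_group_set g j : group_set (col_ker g j).
Proof.
apply/group_setP; split=> [|v w]; first by rewrite inE mul0mx mxE.
by rewrite !inE mulmx_colD => /eqP -> /eqP ->; rewrite addr0.
Qed.

Canonical col_ker_group g j := Group (col_ker_group_set g j).

(** For [v] with value [col_gcd g j], the translates of the kernel by [0, ..., m - 1] times [v] are
    disjoint: these multiples of [col_gcd g j] stay below [N]. *)
Lemma leq_order_card_ker g j :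
  (col_order g j * #|col_ker g j| <= #|'rV['Z_N]_2|)%N.
Proof.
have [v vE] := col_gcd_image g j.
set m := col_order g j; pose f (x : 'I_m * 'rV['Z_N]_2) := x.2 + v *+ x.1.
have f_inj : {in setX [set: 'I_m] (col_ker g j) &, injective f}.
  move=> [a x] [b y] /setXP[_ /=]; rewrite inE => /eqP x0.
  case/setXP=> [_ /=]; rewrite inE => /eqP y0 E.
  have ab : a = b.
    have : (v *+ a *m g) 0 j = (v *+ b *m g) 0 j.
      have := congr1 (fun w => (w *m g) 0 j) E.
      by rewrite /f /= !mulmx_colD x0 y0 !add0r.
    rewrite !mulmx_colMn vE -!mulrnA.
    have ltN (i : 'I_m) : (col_gcd g j * i < N)%N.
      by rewrite -[ltnRHS](col_gcdM_order g j) ltn_pmul2l ?col_gcd_gt0.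
    move/(congr1 val); rewrite /= !val_Zp_nat // !modn_small // => /eqP.
    by rewrite eqn_pmul2l ?col_gcd_gt0 // => /eqP/val_inj.
  by move: E; rewrite ab /f /= => /addIr ->.
by rewrite -{1}(card_ord m) -cardsT -cardsX -(card_in_imset f_inj) max_card.
Qed.

Lemma leq_card_sum_ker g i0 (P : pred 'I_n) :
    (1 < col_order g i0)%N ->
    (forall v, v \notin col_ker g i0 -> exists2 j, P j & v \in col_ker g j) ->
  (#|'rV['Z_N]_2| <= \sum_(j | P j) #|col_ker g j|)%N.
Proof.
move=> m_gt1 cover; rewrite -cardsT.
apply: (@card_le_sum_cover _ _ [set: 'rV['Z_N]_2]%G (col_ker_group g i0)
  (col_ker_group g)) => [|j _|v _]; [|exact: subsetT|exact: cover].
rewrite properEcard subsetT cardsT /=.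
have V_gt0 : (0 < #|'rV['Z_N]_2|)%N by apply/card_gt0P; exists 0.
have := leq_order_card_ker g i0; move: #|_| #|_| V_gt0 => V K.
by nia.
Qed.

Lemma sum_ker_bound g (P : pred 'I_n) c :
    (forall j, P j -> (c <= col_order g j)%N) ->
  (c * \sum_(j | P j) #|col_ker g j| <= #|P| * #|'rV['Z_N]_2|)%N.
Proof.
move=> le_c; rewrite big_distrr -sum_nat_const /=.
rewrite [leqRHS](eq_bigl P) //.
apply: leq_sum => j /le_c le_cj.
by apply: leq_trans (leq_order_card_ker g j); rewrite leq_mul2r le_cj orbT.
Qed.

(** Otherwise the kernels in [P] cover all that lies outside the kernel of [i0], forcing
    [c <= #|P|]. Column [i0] is thus avoided for free, even if its order is only 2. *)
Lemma ker_avoid g i0 (P : pred 'I_n) c :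
    (1 < col_order g i0)%N -> (forall j, P j -> (c <= col_order g j)%N) ->
    (#|P| < c)%N ->
  exists2 v : 'rV['Z_N]_2, (v *m g) 0 i0 != 0
                         & forall j, P j -> (v *m g) 0 j != 0.
Proof.
move=> m_gt1 le_c ltPc.
have [/existsP[v /andP[v0 /forall_inP vP]]|/existsPn nv] :=
  boolP [exists v : 'rV['Z_N]_2, ((v *m g) 0 i0 != 0) &&
          [forall (j | P j), (v *m g) 0 j != 0]].
  by exists v.
have cover v : v \notin col_ker g i0 -> exists2 j, P j & v \in col_ker g j.
  rewrite inE => v0; have := nv v; rewrite v0 /= => /forall_inPn[j Pj].
  by rewrite negbK => vj; exists j; rewrite // inE.
have := leq_card_sum_ker g i0 P m_gt1 cover; have := sum_ker_bound g P c le_c.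
have : (0 < #|'rV['Z_N]_2|)%N by apply/card_gt0P; exists 0.
by move: #|P| #|_| (\sum_(_ | _) _)%N ltPc => p V S; nia.
Qed.

Lemma col_order_mulrn g j k l :
  (col_order (g *+ k) j %| l)%N = (col_order g j %| k * l)%N.
Proof. by rewrite -!col_mulrn_eq0 raddfMn mulrnA. Qed.

(* Chinese remainder theorem: a word whose [q]-part avoids zero on [A] and
   a word whose [r]-part avoids zero off [A] combine into one of full weight. *)
Lemma full_word_coprime g (q r : nat) (A : pred 'I_n) (x y : 'rV['Z_N]_2) :
    coprime q r -> (q * r)%N = N ->
    (forall j, A j -> (y *m g) 0 j *+ r != 0) ->
    (forall j, ~~ A j -> (x *m g) 0 j *+ q != 0) ->
  exists v : 'rV['Z_N]_2, forall j, (v *m g) 0 j != 0.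
Proof.
move=> cqr qrN yA xA; exists (y *+ r + x *+ q) => j.
rewrite mulmx_colD !mulmx_colMn.
set a := (y *m g) 0 j; set b := (x *m g) 0 j.
have killN (z : 'Z_N) : z *+ (q * r) = 0.
  by apply/eqP; rewrite Zp_mulrn_eq0 // qrN dvdn_mulr.
apply/eqP => ab0; case Aj: (A j); last first.
  have/eqP := xA j (negbT Aj); apply.
  apply: (Zp_coprime_mulrn_eq0 N q r) => //; last by rewrite -mulrnA killN.
  have := congr1 (fun z => z *+ q) ab0.
  by rewrite mul0rn mulrnDl -mulrnA [(r * q)%N]mulnC killN add0r.
have/eqP := yA j Aj; apply.
apply: (Zp_coprime_mulrn_eq0 N q r) => //.
  by rewrite -mulrnA mulnC killN.
have := congr1 (fun z => z *+ r) ab0.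
by rewrite mul0rn mulrnDl -[b *+ q *+ r]mulrnA killN addr0.
Qed.

(** * Consequences of thinness, zero sums and content one *)

Lemma mem_generated_code g (v : 'rV['Z_N]_2) : v *m g \in generated_code g.
Proof. by apply/imsetP; exists v; rewrite // mulmx_sum_row. Qed.

Lemma thin_cover g : thin (generated_code g) ->
  forall v : 'rV['Z_N]_2, exists j, v \in col_ker g j.
Proof.
move=> [_ nfull] v; apply/existsP; apply: contraT => /existsPn nv.
case: nfull; exists (v *m g); split; first exact: mem_generated_code.
by move=> i; have := nv i; rewrite inE.
Qed.

(** The columns sum to zero, so a multiple that kills all the others kills column [j]. *)
Lemma col_order_dvd_lcm g j : extended (generated_code g) ->
  (col_order g j %| \big[lcmn/1%N]_(i | i != j) col_order g i)%N.
Proof.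
move=> ext; rewrite -col_mulrn_eq0; set L := \big[_/_]_(_ | _) _.
have sum0 : \sum_i col i g = 0.
  apply/matrixP => k l; rewrite summxE [RHS]mxE.
  have := ext _ (row_generated_code g k).
  by under eq_bigr do rewrite mxE; under [X in _ -> X = _]eq_bigr do rewrite mxE.
have : (\sum_i col i g) *+ L = 0 by rewrite sum0 mul0rn.
rewrite (bigD1 j) //= mulrnDl -sumrMnl big1 ?addr0 => [->//|i ij].
by apply/eqP; rewrite col_mulrn_eq0 (biglcmn_sup i).
Qed.

(** [L] kills every column, so [N / gcdn N L] divides every entry of every word. *)
Lemma content_dvd_lcm g : content (generated_code g) = 1%N ->
  (N %| \big[lcmn/1%N]_i col_order g i)%N.
Proof.
move=> c1; set L := \big[_/_]_(_ | _) _.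
suff: (N %/ gcdn N L %| 1)%N.
  rewrite dvdn_divLR ?gcdn_gt0 ?(ltnW N_gt1) ?dvdn_gcdl // mul1n dvdn_gcd.
  by case/andP.
rewrite -c1 dvdn_gcd dvdn_div ?dvdn_gcdl //=.
apply/dvdn_biggcdP => _ /imsetP[v _ ->]; apply/dvdn_biggcdP => j _.
rewrite dvdn_divLR ?gcdn_gt0 ?(ltnW N_gt1) ?dvdn_gcdl //.
rewrite muln_gcdr dvdn_gcd dvdn_mull //= mulnC -Zp_mulrn_eq0 //.
have /eqP c0 : col j g *+ L == 0 by rewrite col_mulrn_eq0 (biglcmn_sup j).
by rewrite -mulmx_sum_row mulmx_col_mulrn c0 mulmx0 mxE.
Qed.

(** Content one puts [p ^ e] into one order; the zero sum puts it into a second. *)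
Lemma pfactor_dvd_two_cols g (p e : nat) :
    prime p -> (p ^ e %| N)%N -> (0 < e)%N -> admissible (generated_code g) ->
  exists j k, [/\ j != k, (p ^ e %| col_order g j)%N & (p ^ e %| col_order g k)%N].
Proof.
move=> p_pr pN e_gt0 [ext c1].
have [j _ pj] := pfactor_dvd_biglcm _ _ _ _ _ p_pr e_gt0
  (dvdn_trans pN (content_dvd_lcm g c1)).
have [k kj pk] := pfactor_dvd_biglcm _ _ _ _ _ p_pr e_gt0
  (dvdn_trans pj (col_order_dvd_lcm g j ext)).
by exists k, j.
Qed.

End Columns.

Arguments col_order {N n} g j.
Arguments col_ker {N n} g j.

(** * Thin codes with five columns *)

Section FiveColumns.

Variables (N : nat) (g : 'M['Z_N]_(2, 5)) (i0 : 'I_5).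
Hypotheses (N_gt1 : (1 < N)%N) (thin_g : thin (generated_code g)).
Hypothesis ord_i0 : (1 < col_order g i0)%N.

Lemma leq_card_sum_other_ker :
  (#|'rV['Z_N]_2| <= \sum_(j | j != i0) #|col_ker g j|)%N.
Proof.
apply: leq_card_sum_ker ord_i0 _ => // v vi0.
have [j vj] := thin_cover _ _ g thin_g v; exists j => //.
by apply: contraNneq vi0 => <-.
Qed.

(* [1 <= #|B| / b + (4 - #|B|) / c] with denominators cleared. *)
Lemma sum_inv_orders_ge1 (B : {set 'I_5}) (b c : nat) :
    i0 \notin B -> (forall j, j \in B -> (b <= col_order g j)%N) ->
    (forall j, j != i0 -> (c <= col_order g j)%N) ->
  (b * c <= #|B| * c + (4 - #|B|) * b)%N.
Proof.
move=> Bi0 le_b le_c; have := leq_card_sum_other_ker.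
rewrite (bigID (mem B)) /= (eq_bigl (mem B)) => [|j]; last first.
  by rewrite /= andb_idl // => Bj; apply: contraNneq Bi0 => <-.
rewrite [X in (_ + X)%N](eq_bigl (mem (~: (i0 |: B)))) => [|j]; last first.
  by rewrite /= !inE negb_or.
have := sum_ker_bound N 5 N_gt1 g (mem B) b le_b.
have le_cC j : j \in ~: (i0 |: B) -> (c <= col_order g j)%N.
  by rewrite !inE negb_or => /andP[ji0 _]; apply: le_c.
have := sum_ker_bound N 5 N_gt1 g (mem (~: (i0 |: B))) c le_cC.
have -> : #|mem (~: (i0 |: B))| = (4 - #|B|)%N.
  by rewrite -[LHS]/#|~: (i0 |: B)| cardsCs setCK card_ord cardsU1 Bi0.
have : (0 < #|'rV['Z_N]_2|)%N by apply/card_gt0P; exists 0.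
rewrite -[#|mem B|]/#|B|; move: #|_| #|_| (\sum_(_ | _) _)%N (\sum_(_ | _) _)%N.
move=> V k S T V_gt0 leT leS leV.
rewrite -(leq_pmul2r V_gt0) (leq_trans (leq_mul (leqnn _) leV)) //.
move: (leq_mul (leqnn b) leT) (leq_mul (leqnn c) leS).
by move: (4 - k)%N => l; nia.
Qed.

Hypothesis adm_g : admissible (generated_code g).

(** With at most [p] such columns, a word of full weight arises from one avoiding zero on them,
    built in the [p]-part, and one avoiding zero elsewhere. *)
Lemma odd_prime_cols (p : nat) :
    col_order g i0 = 2%N ->
    (forall j, j != i0 -> (2 < col_order g j)%N) ->
    prime p -> (2 < p)%N -> (p %| N)%N ->
  (p < #|[set j | (p %| col_order g j)%N]|)%N.
Proof.
move=> ord2 ord_gt2 p_pr p_gt2 pN; rewrite ltnNge; apply/negP => leAp.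
set A := [set j | _] in leAp.
have [N_gt0 p_gt0] : (0 < N)%N /\ (0 < p)%N by lia.
pose q := (N`_p)%N; pose r := (N`_p^')%N.
have qrN : (q * r)%N = N by rewrite partnC.
have cqr : coprime q r by rewrite coprime_partC.
have npr : ~~ (p %| r)%N.
  rewrite -prime_coprime // coprime_sym.
  exact: p'nat_coprime (part_pnat _ _) (pnat_id p_pr).
have := pfactor_dvd_two_cols N 5 N_gt1 g p 1 p_pr; rewrite expn1.
case=> // j [k [jk Aj Ak]].
have neq_i0 l : (p %| col_order g l)%N -> l != i0.
  by apply: contraTneq => ->; rewrite ord2 gtnNdvd.
have [y yj yA] : exists2 y : 'rV['Z_N]_2, (y *m (g *+ r)) 0 j != 0
    & forall l, l \in A :\ j -> (y *m (g *+ r)) 0 l != 0.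
  (* The order in [g *+ r] divides [q], so it is a power of [p], and not 1 since [p] does not divide
     [r]. With [j] free, fewer than [p] columns remain. *)
  have ord_r l : (p %| col_order g l)%N -> (p <= col_order (g *+ r) l)%N.
    move=> Al; have : (col_order (g *+ r) l %| q)%N.
      by rewrite col_order_mulrn // mulnC qrN dvdn_div ?dvdn_gcdr.
    rewrite /q p_part => /(dvdn_pfactor _ _ p_pr)[[|e] _ E].
      have : (col_order (g *+ r) l %| 1)%N by rewrite E.
      rewrite col_order_mulrn // muln1 => /(dvdn_trans Al).
      by rewrite (negPf npr).
    by rewrite E expnS leq_pmulr // expn_gt0 p_gt0.
  apply: (@ker_avoid N 5 N_gt1 (g *+ r) j (mem (A :\ j)) p).
  - by rewrite (leq_trans _ (ord_r j Aj)) // prime_gt1.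
  - by move=> l /=; rewrite !inE => /andP[_]; apply: ord_r.
  - by move: leAp; rewrite (cardsD1 j) inE Aj.
(* Since [A] contains [j] and [k], at most two columns lie outside [i0 |: A], each of order at least
   3. *)
have [x xi0 xA] : exists2 x : 'rV['Z_N]_2, (x *m g) 0 i0 != 0
    & forall l, l \in ~: (i0 |: A) -> (x *m g) 0 l != 0.
  apply: (@ker_avoid N 5 N_gt1 g i0 (mem (~: (i0 |: A))) 3) => //.
    by move=> l /=; rewrite !inE negb_or => /andP[/ord_gt2].
  rewrite -[#|_|]/#|~: (i0 |: A)| cardsCs setCK card_ord cardsU1 inE.
  rewrite (contraL (neq_i0 i0)) ?eqxx // /=.
  have : (#|[set j; k]| <= #|A|)%N.
    by rewrite subset_leq_card // subUset !sub1set !inE Aj.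
  by rewrite cards2 jk; move: #|A| => a; lia.
have [||v vfull] := full_word_coprime N 5 N_gt1 g q r (mem A) x y cqr qrN.
- move=> l Al; rewrite -mulmxnE -raddfMn /=.
  by have [->|lj] := eqVneq l j; last by apply: yA; rewrite in_setD1 lj.
- move=> l /= Al; have xl : (x *m g) 0 l != 0.
    have [->//|li0] := eqVneq l i0.
    by apply: xA; rewrite !inE negb_or li0; rewrite inE in Al.
  (* Off [A] the order is prime to [q], so multiplying by [q] kills no nonzero value. *)
  apply: contra_neq xl => xq0; apply: (Zp_coprime_mulrn_eq0 _ q (col_order g l)) xq0 _ => //.
  - rewrite /q p_part coprimeXl // prime_coprime //.
    by rewrite inE in Al.
  - exact: mulmx_col_order.
have [l] := thin_cover _ _ g thin_g v.
by rewrite inE (negPf (vfull l)).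
Qed.

End FiveColumns.

(** * The three values of [alpha] *)

Theorem lemma3p6 (N alpha : nat) (hN : (9 <= N)%N)
    (halpha : alpha = 2%N \/ alpha = 3%N \/ alpha = 4%N)
    (halphaN : (alpha %| N)%N)
    (g : 'M['Z_N]_(2, 5))
    (hadm : admissible (generated_code g))
    (hgcd : exists i : 'I_5,
        col_gcd g i = (N %/ alpha)%N /\
        forall j : 'I_5, j != i -> (col_gcd g j < N %/ alpha)%N)
    (hcol : ~ exists i : 'I_5, col i g = 0) :
  ~ thin (generated_code g).
Proof.
move=> thin_g; case: hgcd => i [gcd_i gcd_j].
have N_gt1 : (1 < N)%N by lia.
have alphaE : (N %/ alpha * alpha = N)%N by rewrite divnK.
have ord_i : col_order g i = alpha.
  have := col_gcdM_order N 5 g i; rewrite gcd_i; nia.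
have ord_j j : j != i -> (alpha < col_order g j)%N.
  by move/gcd_j; have := col_gcdM_order N 5 g j; nia.
have ord_gt1 : (1 < col_order g i)%N by rewrite ord_i; lia.
have bound := sum_inv_orders_ge1 N g i N_gt1 thin_g ord_gt1.
have two_cols p e := pfactor_dvd_two_cols N 5 N_gt1 g p e.
case: halpha => [a2|[a3|a4]]; last 2 first.
(* For [alpha = 3], a multiple of 3 above 3 is at least 6, and [1/6 + 3/4 < 1]. *)
- have [j ji dvj] : exists2 j, j != i & (3 %| col_order g j)%N.
    have := two_cols 3%N 1%N; rewrite expn1; case=> // [|j [k [jk dj dk]]]; first by move: halphaN; rewrite a3.
    have [ji|ji] := eqVneq j i; last by exists j.
    by exists k; rewrite // -ji eq_sym.
  suff: (6 * 4 <= #|[set j]| * 4 + (4 - #|[set j]|) * 6)%N by rewrite cards1.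
  apply: bound => [|l /set1P ->|l /ord_j]; [|move: dvj|by rewrite a3].
    by rewrite inE eq_sym.
  by have := ord_j j ji; rewrite a3; move: (col_order g j); lia.
(* For [alpha = 4], [4/5 < 1]; the set [B] is empty and [b = 1] a filler. *)
- suff: (1 * 5 <= #|@set0 'I_5| * 5 + (4 - #|@set0 'I_5|) * 1)%N.
    by rewrite cards0.
  by apply: bound => [|l|l /ord_j]; rewrite ?inE // a4.
rewrite a2 in ord_i ord_j halphaN.
have two_large j k : j != k -> (9 <= col_order g j)%N ->
    (9 <= col_order g k)%N -> False.
  move=> jk gej gek.
  suff: (9 * 3 <= #|[set j; k]| * 3 + (4 - #|[set j; k]|) * 9)%N.
    by rewrite cards2 jk.
  apply: bound => // [|l /set2P[]->//].
  by apply/negP => /set2P[E|E]; [move: gej|move: gek]; rewrite -E ord_i.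
(* Column [i] has order 2, so [2 < p < #|A| <= 4]: hence [p = 3] and [A] is everything but [i]. *)
have odd_p p : prime p -> (p %| N)%N -> p != 2%N ->
    p = 3%N /\ forall j, j != i -> (3 %| col_order g j)%N.
  move=> p_pr pN p2; have p_gt2 : (2 < p)%N by have := prime_gt1 p_pr; lia.
  have := odd_prime_cols N g i N_gt1 thin_g ord_gt1 hadm p ord_i ord_j p_pr p_gt2 pN.
  set A := [set j | _] => ltpA.
  have Ai : i \notin A by rewrite inE ord_i gtnNdvd.
  have sub4 : (#|A| <= 4)%N.
    by have := max_card (i |: A); rewrite card_ord cardsU1 Ai.
  have p3 : p = 3%N by lia.
  split=> // j ji; suff : (p %| col_order g j)%N by rewrite p3.
  apply: contraLR ltpA => pj.
  have := max_card (j |: (i |: A)).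
  rewrite card_ord !cardsU1 Ai !inE negb_or ji pj p3 /=; move: #|A| => a; lia.
have pN_large p e :
    prime p -> (0 < e)%N -> (p ^ e %| N)%N -> (9 <= p ^ e)%N -> False.
  move=> p_pr e_gt0 peN ge9.
  have [j [k [jk dj dk]]] := two_cols p e p_pr peN e_gt0 hadm.
  by apply: (two_large j k) => //; apply: leq_trans ge9 _; apply: dvdn_leq;
    rewrite ?col_order_gt0.
(* Without the factor 3, [N] is itself a power of 2 that is at least 9. *)
have [dv3|ndv3] := boolP (3 %| N)%N; last first.
  have N2 : (2.-nat N)%N.
    apply/pnatP=> [|p p_pr pN]; first by lia.
    apply: contraNT ndv3 => p2.
    by have [p3 _] := odd_p p p_pr pN p2; rewrite p3 in pN.
  have NE : (2 ^ logn 2 N = N)%N by rewrite -p_part part_pnat_id.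
  apply: (pN_large 2%N (logn 2 N)); rewrite ?NE //.
  by rewrite -pfactor_dvdn //; lia.
have [_ dv3j] := odd_p 3%N isT dv3 isT.
have ndv9 : ~~ (9 %| N)%N by apply/negP => /(pN_large 3%N 2%N isT isT)/(_ isT).
have ndv4 : ~~ (4 %| N)%N.
  (* Two orders divisible by 4 are also divisible by 3, hence at least 12. *)
  apply/negP => /(two_cols 2%N 2%N isT)/(_ isT hadm)[j [k [jk dj dk]]].
  have ge9 l : (4 %| col_order g l)%N -> (9 <= col_order g l)%N.
    move=> dl; have li : l != i by apply: contraTneq dl => ->; rewrite ord_i.
    have : (4 * 3 %| col_order g l)%N by rewrite Gauss_dvd // dl dv3j.
    by move/dvdn_leq => /(_ (col_order_gt0 _ _ N_gt1 _ _)) /(leq_trans _); apply.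
  exact: (two_large j k jk (ge9 j dj) (ge9 k dk)).
(* Now [M > 1] is prime to 6, so its least prime factor contradicts [odd_p]. *)
pose M := (N %/ 6)%N; have NE : (N = M * 6)%N by lia.
have p_pr : prime (pdiv M) by rewrite pdiv_prime //; lia.
have dvM := pdiv_dvd M.
have dvN : (pdiv M %| N)%N by rewrite NE dvdn_mulr.
have p2 : pdiv M != 2%N by apply/eqP => E; move: dvM; rewrite E; lia.
have [p3 _] := odd_p _ p_pr dvN p2.
by move: dvM; rewrite p3; lia.
Qed.
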